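(* Let $n=2^k$ with $k\in\{0,1,2,\dots\}$. The function $$z(x)=x^{\frac{n^2}{2}}J_n\Big(\frac{2}{n}x^{\frac n2}\Big)$$ is a solution on $x>0$ of the ordinary differential equation $$x z''-(n^2-1)z'+x^{n-1}z=0 .$$
   Context: $J_n$ denotes the Bessel function of the first kind of order $n$, $J_n(x)=\sum_{j=0}^\infty \frac{(-1)^j}{j!\,\Gamma(j+n+1)}\left(\frac{x}{2}\right)^{2j+n}$. *)

(* Defs.v *)
From Stdlib Require Import Reals Factorial.
From Coquelicot Require Import Coquelicot.
Open Scope R_scope.

(** Euler's integral over (0, +oo), improper at both ends; meaningful for
    [s > 0], the only arguments at which it is used below. *)
Definition Gamma (s : R) : R :=
  RInt_gen (fun t : R => Rpower t (s - 1) * exp (- t))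
    (at_right 0) (Rbar_locally p_infty).

Definition besselJ (n : nat) (x : R) : R :=
  Series (fun j : nat =>
    (-1) ^ j / (INR (fact j) * Gamma (INR j + INR n + 1))
    * (x / 2) ^ (2 * j + n)).

(** [Rpower] is the usual real power only on positive arguments, so this is the
    intended function for [x > 0] and carries no meaning elsewhere. *)
Definition z_sol (n : nat) (x : R) : R :=
  Rpower x (INR n ^ 2 / 2) * besselJ n (2 / INR n * Rpower x (INR n / 2)).

(* Main.v *)
Require Import Defs.
From Stdlib Require Import Reals Factorial Lra Lia.
From Coquelicot Require Import Coquelicot.
Open Scope R_scope.

(** With [C_n(u) = sum_j u^j / (j! (j+n)!)] (the Bessel-Clifford function), the
    Gamma values at positive integers being factorials ([Gamma_nat]), one has
    [J_n(y) = (y/2)^n C_n(-(y/2)^2)].  At [y = (2/n) x^(n/2)] both [(y/2)^2] and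
    [x^(n^2/2) (y/2)^n] lose their fractional powers, so that on [x > 0]
<<
      z(x) = n^(-n) x^(n^2) C_n(-x^n / n^2)      ([z_sol_bessel_clifford]).
>>
    The coefficients of the entire function [C_n] satisfy
    [j (j+n) c_j = c_(j-1)], which is the equation
    [u f'' + (n+1) f' = f] ([bessel_clifford_ode]).

    Put [u = -x^n / n^2], so that [u' = n u / x].  Then
    [z' = n^(-n) (n/x) x^(n^2) (n f + u f')], and in [x z'' - (n^2-1) z'] the terms
    [n^2 f] cancel and what remains is
    [n^(-n) (n^2/x) x^(n^2) u (u f'' + (n+1) f')].  The equation of [f] turns the
    last factor into [f], and [(n^2/x) u = -x^(n-1)], which gives [-x^(n-1) z]
    ([clifford_substitution]). *)

(** * Gamma at positive integers *)

Lemma pow_div_fact_le_exp (m : nat) (t : R) :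
  0 <= t -> t ^ m / INR (fact m) <= exp t.
Proof.
  intros Ht.
  assert (Hpos : forall j, 0 <= t ^ j / INR (fact j)).
  { intros j. apply Rmult_le_pos; [now apply pow_le|].
    apply Rlt_le, Rinv_0_lt_compat, INR_fact_lt_0. }
  apply Rle_trans with (2 := exp_ge_taylor t m Ht).
  destruct m as [|m]; [simpl; lra|].
  rewrite tech5.
  assert (H := cond_pos_sum (fun j => t ^ j / INR (fact j)) m Hpos).
  simpl in H |- *; lra.
Qed.

(** The previous bound at exponent [m + 1] squeezes the function between [0] and
    [(m+1)! / t]. *)
Lemma is_lim_pow_mul_exp_opp (m : nat) :
  is_lim (fun t => t ^ m * exp (- t)) p_infty 0.
Proof.
  apply is_lim_le_le_loc with (f := fun _ => 0) (g := fun t => INR (fact (S m)) * / t).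
  - exists 0; intros t Ht; split.
    + apply Rmult_le_pos; [apply pow_le; lra | apply Rlt_le, exp_pos].
    + assert (H := pow_div_fact_le_exp (S m) t (Rlt_le _ _ Ht)).
      assert (HF := INR_fact_lt_0 (S m)).
      assert (HE := exp_pos t).
      rewrite exp_Ropp.
      apply Rmult_le_reg_r with (t * exp t / INR (fact (S m))).
      { apply Rdiv_lt_0_compat; [nra | assumption]. }
      replace (t ^ m * / exp t * (t * exp t / INR (fact (S m))))
        with (t ^ S m / INR (fact (S m))) by (simpl pow; field; lra).
      replace (INR (fact (S m)) * / t * (t * exp t / INR (fact (S m))))
        with (exp t) by (field; lra).
      exact H.
  - apply is_lim_const.
  - replace (Finite 0) with (Rbar_mult (INR (fact (S m))) 0)
      by (simpl; now rewrite Rmult_0_r).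
    apply is_lim_scal_l.
    apply (is_lim_inv (fun t => t) p_infty p_infty); [apply is_lim_id | discriminate].
Qed.

(** The antiderivative of [t^m exp(-t)] given by repeated integration by parts. *)
Fixpoint gamma_primitive (m : nat) (t : R) : R :=
  match m with
  | O => - exp (- t)
  | S p => INR (S p) * gamma_primitive p t - t ^ S p * exp (- t)
  end.

Lemma is_derive_gamma_primitive (m : nat) (t : R) :
  is_derive (gamma_primitive m) t (t ^ m * exp (- t)).
Proof.
  revert t; induction m as [|m IH]; intros t.
  - simpl. auto_derive; [exact I | ring].
  - apply is_derive_ext
      with (fun s => INR (S m) * gamma_primitive m s - s ^ S m * exp (- s));
      [reflexivity|].
    replace (t ^ S m * exp (- t)) with
      (INR (S m) * (t ^ m * exp (- t))
       - (INR (S m) * t ^ m * exp (- t) - t ^ S m * exp (- t))) by ring.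
    apply @is_derive_minus.
    + apply is_derive_scal, IH.
    + auto_derive; [exact I|]. rewrite S_INR. destruct m; simpl; ring.
Qed.

Lemma gamma_primitive_0 (m : nat) : gamma_primitive m 0 = - INR (fact m).
Proof.
  induction m as [|m IH].
  - simpl. rewrite Ropp_0, exp_0. reflexivity.
  - change (gamma_primitive (S m) 0)
      with (INR (S m) * gamma_primitive m 0 - 0 ^ S m * exp (- 0)).
    rewrite IH, fact_simpl, mult_INR, pow_i by lia. ring.
Qed.

Lemma is_lim_gamma_primitive (m : nat) : is_lim (gamma_primitive m) p_infty 0.
Proof.
  induction m as [|m IH].
  - apply is_lim_ext with (fun t => - (t ^ 0 * exp (- t))).
    { intros t; simpl; ring. }
    replace (Finite 0) with (Rbar_opp 0) by (simpl; now rewrite Ropp_0).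
    apply is_lim_opp, is_lim_pow_mul_exp_opp.
  - apply is_lim_ext
      with (fun s => INR (S m) * gamma_primitive m s - s ^ S m * exp (- s));
      [reflexivity|].
    apply is_lim_minus with (Finite 0) (Finite 0).
    + replace (Finite 0) with (Rbar_mult (INR (S m)) 0)
        by (simpl; now rewrite Rmult_0_r).
      apply is_lim_scal_l, IH.
    + apply is_lim_pow_mul_exp_opp.
    + unfold is_Rbar_minus, is_Rbar_plus; simpl. do 2 f_equal. ring.
Qed.

(** [gamma_primitive m] increases from [-m!] at [0] to [0] at infinity. *)
Lemma Gamma_nat (m : nat) : Gamma (INR m + 1) = INR (fact m).
Proof.
  unfold Gamma. apply is_RInt_gen_unique.
  apply is_RInt_gen_ext with (Derive (gamma_primitive m)).
  - (* the two integrands agree only for positive [t] *)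
    apply Filter_prod with (Q := fun a => 0 < a) (R := fun b => 0 < b).
    + exists (mkposreal 1 Rlt_0_1); intros y _ Hy; exact Hy.
    + exists 0; auto.
    + intros a b Ha Hb t [Ht _]. simpl in Ht.
      assert (0 < t) by (apply Rlt_trans with (2 := Ht); now apply Rmin_glb_lt).
      rewrite (is_derive_unique _ _ _ (is_derive_gamma_primitive m t)).
      replace (INR m + 1 - 1) with (INR m) by ring.
      now rewrite Rpower_pow.
  - replace (INR (fact m)) with (0 - gamma_primitive m 0)
      by (rewrite gamma_primitive_0; ring).
    apply is_RInt_gen_Derive.
    + apply filter_forall; intros ab t _.
      eexists; apply is_derive_gamma_primitive.
    + apply filter_forall; intros ab t _.
      apply continuous_ext with (fun s => s ^ m * exp (- s)).
      { intros s; symmetry; apply is_derive_unique, is_derive_gamma_primitive. }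
      apply @ex_derive_continuous. auto_derive; exact I.
    + apply (@filterlim_filter_le_1 _ _ (locally 0)).
      * intros P [e He]; exists e; intros y Hy _; now apply He.
      * apply @ex_derive_continuous.
        eexists; apply is_derive_gamma_primitive.
    + exact (is_lim_gamma_primitive m).
Qed.

(** * The Bessel-Clifford function *)

Definition clifford_coef (n j : nat) : R := / (INR (fact j) * INR (fact (j + n))).

(** The operator [u d^2/du^2 + (n+1) d/du] sends [u^j] to [j (j+n) u^(j-1)], so this
    recurrence is the differential equation of the power series. *)
Lemma clifford_coef_S (n j : nat) :
  INR (S j) * (INR (S j) + INR n) * clifford_coef n (S j) = clifford_coef n j.
Proof.
  unfold clifford_coef.
  rewrite Nat.add_succ_l, !fact_simpl, !mult_INR, <- plus_INR, Nat.add_succ_l.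
  assert (H1 := INR_fact_neq_0 j). assert (H2 := INR_fact_neq_0 (j + n)).
  assert (H3 := not_0_INR (S j) (Nat.neq_succ_0 _)).
  assert (H4 := not_0_INR (S (j + n)) (Nat.neq_succ_0 _)).
  field; auto.
Qed.

(** The ratio of consecutive coefficients is [1 / ((j+1) (j+1+n))]. *)
Lemma CV_radius_clifford (n : nat) : CV_radius (clifford_coef n) = p_infty.
Proof.
  assert (Hc : forall j, 0 < clifford_coef n j).
  { intros j. apply Rinv_0_lt_compat, Rmult_lt_0_compat; apply INR_fact_lt_0. }
  apply CV_radius_infinite_DAlembert.
  { intros j. apply Rgt_not_eq, Hc. }
  apply is_lim_seq_le_le with (u := fun _ => 0) (w := fun j => / INR (S j)).
  - intros j; split; [apply Rabs_pos|].
    assert (H1 := Hc (S j)).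
    rewrite <- (clifford_coef_S n j).
    assert (H2 := pos_INR n). assert (H3 := pos_INR j). rewrite S_INR.
    replace (clifford_coef n (S j) / ((INR j + 1) * (INR j + 1 + INR n) * clifford_coef n (S j)))
      with (/ ((INR j + 1) * (INR j + 1 + INR n))) by (field; lra).
    rewrite Rabs_pos_eq by (apply Rlt_le, Rinv_0_lt_compat; nra).
    apply Rinv_le_contravar; nra.
  - apply is_lim_seq_const.
  - apply (is_lim_seq_incr_1 (fun j => / INR j)).
    apply is_lim_seq_inv with (l := p_infty); [apply is_lim_seq_INR | discriminate].
Qed.

Lemma bessel_clifford_ode (n : nat) (u : R) :
  u * PSeries (PS_derive (PS_derive (clifford_coef n))) u
  + (INR n + 1) * PSeries (PS_derive (clifford_coef n)) u
  = PSeries (clifford_coef n) u.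
Proof.
  assert (Hex : forall a, CV_radius a = p_infty -> ex_pseries a u).
  { intros a Ha. apply CV_radius_inside. now rewrite Ha. }
  assert (H1 : CV_radius (PS_derive (clifford_coef n)) = p_infty)
    by now rewrite CV_radius_derive, CV_radius_clifford.
  assert (H2 : CV_radius (PS_derive (PS_derive (clifford_coef n))) = p_infty)
    by now rewrite CV_radius_derive.
  rewrite <- PSeries_incr_1, <- PSeries_scal, <- PSeries_plus.
  - apply PSeries_ext; intros j. rewrite <- (clifford_coef_S n j).
    unfold PS_plus, PS_scal, PS_incr_1, PS_derive, plus, scal; simpl.
    unfold mult; simpl. destruct j as [|j]; [simpl; unfold zero; simpl; ring|].
    rewrite S_INR. destruct j; simpl; ring.
  - apply ex_pseries_incr_1, Hex, H2.
  - apply ex_pseries_scal; [apply Rmult_comm | apply Hex, H1].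
Qed.

Lemma besselJ_bessel_clifford (n : nat) (y : R) :
  besselJ n y = (y / 2) ^ n * PSeries (clifford_coef n) (- (y / 2) ^ 2).
Proof.
  unfold besselJ, PSeries. rewrite <- Series_scal_l.
  apply Series_ext; intros j.
  rewrite <- plus_INR, Gamma_nat, pow_add, pow_mult. unfold clifford_coef.
  replace (- (y / 2) ^ 2) with (-1 * (y / 2) ^ 2) by ring.
  rewrite Rpow_mult_distr. unfold Rdiv. ring.
Qed.

Lemma z_sol_bessel_clifford (n : nat) (x : R) :
  (0 < n)%nat -> 0 < x ->
  z_sol n x =
  / INR n ^ n * (x ^ (n * n) * PSeries (clifford_coef n) (- (x ^ n / INR n ^ 2))).
Proof.
  intros Hn Hx. assert (Hn' := lt_0_INR n Hn).
  unfold z_sol. rewrite besselJ_bessel_clifford.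
  set (r := Rpower x (INR n / 2)).
  assert (Hr : 0 < r) by apply exp_pos.
  replace (2 / INR n * r / 2) with (r * / INR n) by (field; lra).
  assert (Hr2 : r ^ 2 = x ^ n).
  { rewrite <- (Rpower_pow 2 r Hr). unfold r. rewrite Rpower_mult, <- (Rpower_pow n x Hx).
    f_equal. simpl. field. }
  assert (Hrn : Rpower x (INR n ^ 2 / 2) * r ^ n = x ^ (n * n)).
  { rewrite <- (Rpower_pow n r Hr). unfold r.
    rewrite Rpower_mult, <- Rpower_plus, <- (Rpower_pow (n * n) x Hx).
    f_equal. rewrite mult_INR. field. }
  rewrite !Rpow_mult_distr, Hr2, <- Hrn, !pow_inv. unfold Rdiv. ring.
Qed.

(** * Transformation of the differential equation *)

Lemma pow_pred_eq_div (n : nat) (x : R) :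
  (0 < n)%nat -> x <> 0 -> x ^ (n - 1) = x ^ n / x.
Proof.
  intros Hn Hx. destruct n as [|n]; [lia|].
  replace (S n - 1)%nat with n by lia. simpl. field. exact Hx.
Qed.

(** As [x^(n^2)] and [u = -x^n / n^2] are monomials in [x], the operator [x d/dx]
    multiplies the first by [n^2] and the second by [n]. *)
Lemma is_derive_pow_mul_comp (n : nat) (g g1 : R -> R) (x : R) :
  (0 < n)%nat -> (forall v, is_derive g v (g1 v)) -> x <> 0 ->
  let u t := - (t ^ n / INR n ^ 2) in
  is_derive (fun t => t ^ (n * n) * g (u t)) x
    (INR n / x * (x ^ (n * n) * (INR n * g (u x) + u x * g1 (u x)))).
Proof.
  intros Hn Hg Hx u. assert (Hn' := lt_0_INR n Hn). unfold u.
  auto_derive.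
  - eexists; apply Hg.
  - rewrite (is_derive_unique (fun x : R => g x) _ _ (Hg _)).
    rewrite <- !Nat.sub_1_r, !pow_pred_eq_div, mult_INR by (nia || assumption).
    unfold Rdiv; simpl; field; lra.
Qed.

(** The first derivative has again the form of [w], up to the factor [n / x], with
    [f] replaced by [n f + v f1]; so the second derivative comes from the same
    formula. *)
Lemma clifford_substitution (n : nat) (K : R) (f f1 f2 w : R -> R) (x : R) :
  (0 < n)%nat ->
  (forall v, is_derive f v (f1 v)) ->
  (forall v, is_derive f1 v (f2 v)) ->
  (forall v, v * f2 v + (INR n + 1) * f1 v = f v) ->
  (forall t, 0 < t -> w t = K * (t ^ (n * n) * f (- (t ^ n / INR n ^ 2)))) ->
  0 < x ->
  ex_derive w x /\
  ex_derive (Derive w) x /\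
  x * Derive (Derive w) x - (INR n ^ 2 - 1) * Derive w x + x ^ (n - 1) * w x = 0.
Proof.
  intros Hn Hf Hf1 Hode Hw Hx. assert (Hn' := lt_0_INR n Hn).
  set (u := fun t => - (t ^ n / INR n ^ 2)).
  set (g := fun v => INR n * f v + v * f1 v).
  set (g1 := fun v => INR n * f1 v + (f1 v + v * f2 v)).
  assert (Hg : forall v, is_derive g v (g1 v)).
  { intros v. unfold g, g1. auto_derive.
    - repeat split; eexists; [apply Hf | apply Hf1].
    - rewrite (is_derive_unique (fun x : R => f x) _ _ (Hf v)),
        (is_derive_unique (fun x : R => f1 x) _ _ (Hf1 v)). ring. }
  assert (Hpos : forall t, 0 < t -> locally t (fun s => 0 < s)).
  { intros t Ht. exact (open_gt 0 t Ht). }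
  assert (D1 : forall t, 0 < t ->
    is_derive w t (K * (INR n / t * (t ^ (n * n) * g (u t))))).
  { intros t Ht.
    apply is_derive_ext_loc with (fun s => K * (s ^ (n * n) * f (u s))).
    - apply filter_imp with (2 := Hpos t Ht).
      intros s Hs. symmetry. now apply Hw.
    - apply is_derive_scal, is_derive_pow_mul_comp; [assumption | assumption | lra]. }
  assert (D2 : is_derive (Derive w) x
    (K * (- INR n / x ^ 2 * (x ^ (n * n) * g (u x))
          + INR n / x * (INR n / x * (x ^ (n * n) * (INR n * g (u x) + u x * g1 (u x))))))).
  { apply is_derive_ext_loc with (fun s => K * (INR n / s * (s ^ (n * n) * g (u s)))).
    - apply filter_imp with (2 := Hpos x Hx).
      intros s Hs. symmetry. now apply is_derive_unique, D1.
    - apply is_derive_scal.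
      apply (is_derive_mult (fun s => INR n / s) (fun s => s ^ (n * n) * g (u s)) x);
        [| | exact Rmult_comm].
      + auto_derive; [lra | field; lra].
      + apply is_derive_pow_mul_comp; [assumption | assumption | lra]. }
  split; [eexists; now apply D1|]. split; [eexists; exact D2|].
  rewrite (is_derive_unique _ _ _ D2), (is_derive_unique _ _ _ (D1 x Hx)), (Hw x Hx).
  fold (u x). unfold g, g1.
  rewrite pow_pred_eq_div by (assumption || lra).
  rewrite <- (Hode (u x)).
  replace (x ^ n) with (- (INR n ^ 2 * u x)) by (unfold u; field; lra).
  field; lra.
Qed.

Theorem mainTheorem3 (k n : nat) (hn : n = (2 ^ k)%nat) (x : R) (hx : 0 < x) :
  ex_derive (z_sol n) x /\
  ex_derive (Derive (z_sol n)) x /\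
  x * Derive (Derive (z_sol n)) x - (INR n ^ 2 - 1) * Derive (z_sol n) x
    + x ^ (n - 1) * z_sol n x = 0.
Proof.
  assert (Hn : (0 < n)%nat) by (subst n; apply Nat.neq_0_lt_0, Nat.pow_nonzero; lia).
  assert (HP : forall a v, CV_radius a = p_infty ->
    is_derive (PSeries a) v (PSeries (PS_derive a) v)).
  { intros a v Ha. apply is_derive_PSeries. now rewrite Ha. }
  apply clifford_substitution with
    (f := PSeries (clifford_coef n))
    (f1 := PSeries (PS_derive (clifford_coef n)))
    (f2 := PSeries (PS_derive (PS_derive (clifford_coef n))))
    (K := / INR n ^ n); try assumption.
  - intros v. apply HP, CV_radius_clifford.
  - intros v. apply HP. now rewrite CV_radius_derive, CV_radius_clifford.
  - apply bessel_clifford_ode.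
  - intros t Ht. now apply z_sol_bessel_clifford.
Qed.
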